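(* Let $X$ be a weakly Lindelöf space such that $\pi w(X)<cov(\mathcal{M})$. Then $X$ is weakly Rothberger.
   Context: A space is weakly Lindelöf if every open cover has a countable subcollection with dense union. A $\pi$-base for $X$ is a family $\mathcal{P}$ of non-empty open sets such that every non-empty open $U\subset X$ contains some $P\in\mathcal{P}$; $\pi w(X)$ is the minimum cardinality of a $\pi$-base for $X$. $cov(\mathcal{M})$ is the least cardinality of a family of meager subsets of the real line covering the real line (equivalently, the least cardinality of a cover of $\omega^\omega$ by nowhere dense sets). $X$ is weakly Rothberger if for every sequence $(\mathcal{U}_n)_{n<\omega}$ of open covers of $X$ one can choose $U_n\in\mathcal{U}_n$ for each $n<\omega$ such that $\bigcup_{n<\omega}U_n$ is dense in $X$. *)

(* Defs.v *)
From HB Require Import structures.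
From mathcomp Require Import all_boot all_order all_algebra.
From mathcomp Require Import all_classical all_reals all_analysis.
Set Implicit Arguments.
Unset Strict Implicit.
Unset Printing Implicit Defensive.
Import Order.TTheory GRing.Theory Num.Theory.
Import numFieldNormedType.Exports.
Local Open Scope classical_set_scope.
Local Open Scope card_scope.

Definition card_lt T U (A : set T) (B : set U) : Prop :=
  (A #<= B) /\ ~ (A #= B).

(* The least cardinality of a member of [C] is represented by a chosen member
   of [C] that injects into every other one; [least_cardP] shows that it exists
   as soon as [C] is nonempty. *)
Definition least_card T (C : set (set T)) : set T :=
  get [set A | C A /\ forall B, C B -> A #<= B].

Lemma least_cardP T (C : set (set T)) : C !=set0 ->
  C (least_card C) /\ forall B, C B -> least_card C #<= B.
Proof.
move=> [C0 CC0].
suff [A Amin] : exists A, C A /\ forall B, C B -> A #<= B.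
  exact: (@getI _ [set A | C A /\ forall B, C B -> A #<= B] A).
pose S (F : set (set T -> T)) :=
  (forall f B, F f -> C B -> B (f B)) /\
  (forall f g B, F f -> F g -> C B -> f B = g B -> f = g).
have [F FS Ftot|F [[FC Finj] Fmax]] := @Zorn_bigcup _ S.
  split=> [f B [G FG Gf] CB|f g B [G FG Gf] [H FH Hg] CB fg].
    by have [GC _] := FS _ FG; exact: GC f B Gf CB.
  have [_ Ginj] := FS _ FG; have [_ Hinj] := FS _ FH.
  have [GH|HG] := Ftot _ _ FG FH.
  - exact: Hinj (GH _ Gf) Hg CB fg.
  - exact: Ginj Gf (HG _ Hg) CB fg.
have [A [CA AF]] : exists A, C A /\ A `<=` (fun f => f A) @` F.
  apply: contrapT => /forallNP noA.
  have ex B : C B -> exists2 x, B x & ~ ((fun f => f B) @` F) x.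
    by move=> CB; apply: contrapT => h; apply: (noA B); split=> // x Bx;
      apply: contrapT => nx; apply: h; exists x.
  have [x0 _ _] := ex _ CC0.
  have /choice[g gP] : forall B, exists x,
      C B -> B x /\ ~ ((fun f => f B) @` F) x.
    move=> B; have [/ex[x Bx nx]|nCB] := pselect (C B); first by exists x.
    by exists x0.
  apply: (Fmax (F `|` [set g])).
    split; first by left.
    by move=> /(_ g (or_intror erefl)) Fg; apply: (gP _ CC0).2; exists g.
  split=> [f B [Ff|->] CB|f h B]; [exact: FC f B Ff CB|exact: (gP _ CB).1|].
  move=> [Ff|->] [Fh|->] CB // fh.
  - exact: Finj f h B Ff Fh CB fh.
  - by case: (gP _ CB).2; exists f.
  - by case: (gP _ CB).2; exists h.
exists A; split=> // B CB.
apply: card_le_trans (subset_card_le AF) _.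
apply: card_le_trans (card_image_le _ _) _.
have Binj : {in F &, injective (fun f : set T -> T => f B)}.
  by move=> f h /set_mem Ff /set_mem Fh; exact: Finj.
have /card_eqPle[_ FB] := inj_card_eq Binj.
apply: card_le_trans FB (subset_card_le _).
by move=> _ [f Ff <-]; exact: FC f B Ff CB.
Qed.

Section topology.
Context {X : topologicalType}.
Implicit Types (U V P : set (set X)) (A : set X).

Definition open_cover U : Prop :=
  U `<=` open /\ \bigcup_(A in U) A = [set: X].

Definition pi_base P : Prop :=
  (forall A, P A -> open A /\ A !=set0) /\
  (forall A, open A -> A !=set0 -> exists2 B, P B & B `<=` A).

Definition nowhere_dense A : Prop := interior (closure A) = set0.

Definition meager A : Prop :=
  exists2 N : nat -> set X,
    forall n, nowhere_dense (N n) & A = \bigcup_n N n.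

End topology.

Definition weakly_lindelof (X : topologicalType) : Prop :=
  forall U : set (set X), open_cover U ->
    exists V : set (set X),
      [/\ V `<=` U, countable V & dense (\bigcup_(A in V) A)].

(* The empty family covers the empty space and offers nothing to select, so the
   empty space, though weakly Lindelof, does not satisfy this predicate. *)
Definition weakly_rothberger (X : topologicalType) : Prop :=
  forall U : nat -> set (set X), (forall n, open_cover (U n)) ->
    exists2 A : nat -> set X,
      forall n, U n (A n) & dense (\bigcup_n A n).

Definition pi_weight (X : topologicalType) : set (set X) :=
  least_card [set P | pi_base P].
Arguments pi_weight : clear implicits.

Definition meager_cover {R : realType} (F : set (set R)) : Prop :=
  F `<=` meager /\ \bigcup_(M in F) M = [set: R].

Definition cov_meager (R : realType) : set (set R) :=
  least_card [set F | meager_cover F].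
Arguments cov_meager : clear implicits.

Lemma pi_weightP (X : topologicalType) : pi_base (pi_weight X) /\
  forall P : set (set X), pi_base P -> pi_weight X #<= P.
Proof.
apply: least_cardP; exists [set A | open A /\ A !=set0].
by split=> // A oA A0; exists A.
Qed.

Lemma cov_meagerP (R : realType) : meager_cover (cov_meager R) /\
  forall F : set (set R), meager_cover F -> cov_meager R #<= F.
Proof.
apply: least_cardP; exists [set [set x] | x in [set: R]]; split; last first.
  by rewrite -subTset => x _; exists [set x] => //; exists x.
move=> _ [x _ <-]; exists (fun=> [set x]); last by rewrite bigcup_const.
move=> _; rewrite /nowhere_dense.
have /closure_id <- : closed [set x] by exact: closed_eq.
by rewrite interior_set1.
Qed.

(* Main.v *)
(** Enumerate the countable subfamilies with dense union as [V n k].  It suffices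
    to find [x] and [d] such that, for every [P] of a fixed pi-base, [V n (d n x)]
    meets [P] for some [n].  We take [d n] real functions such that every nonempty
    open set contains, for one fixed [n], nonempty open sets on which [d n] takes
    each constant value: they play the role of the coordinates of the Baire space.
    Then the set of the [x] that are bad for a given [P] is nowhere dense, and the
    pi-base is too small for these sets to cover the real line. *)
Require Import Defs.
From mathcomp Require Import all_boot all_order all_algebra.
From mathcomp Require Import all_classical all_reals all_analysis.
Import Order.TTheory GRing.Theory Num.Theory.
Import numFieldNormedType.Exports.
Local Open Scope classical_set_scope.

Lemma nowhere_dense_subset_open (T : topologicalType) (A : set T) :
  (forall I, open I -> I !=set0 ->
    exists J, [/\ open J, J !=set0, J `<=` I & J `&` A = set0]) ->
  nowhere_dense A.
Proof.
move=> h; rewrite /nowhere_dense -subset0 => a Aa.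
have [J [oJ [y Jy] JI JA]] := h _ (open_interior (closure A)) (ex_intro _ a Aa).
have [z [Az Jz]] := interior_subset (JI _ Jy) J (open_nbhs_nbhs (conj oJ Jy)).
by have : (J `&` A) z by []; rewrite JA.
Qed.

Lemma meager_nowhere_dense (T : topologicalType) (A : set T) :
  nowhere_dense A -> meager A.
Proof. by move=> ndA; exists (fun=> A); rewrite ?bigcup_const. Qed.

Section real_coordinates.
Context {R : realType}.
Local Open Scope ring_scope.

(* The 2-adic valuation takes every value on arbitrarily large integers, hence
   [x |-> logn 2 (trunc (x - q)^-1)] takes every value arbitrarily close to [q]. *)
Definition coordinate (n : nat) (x : R) : nat :=
  logn 2 (Num.truncn (x - ratr (odflt 0 (unpickle n)))^-1).

Lemma coordinateP (I : set R) : open I -> I !=set0 ->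
  exists n, forall k, exists J,
    [/\ open J, J !=set0, J `<=` I & forall x, J x -> coordinate n x = k].
Proof.
move=> oI I0; have [_ [/[swap] [[q _ <-]] Iq]] := dense_rat I0 oI.
have /nbhs_ballP[e /= e0 eI] := open_nbhs_nbhs (conj oI Iq).
exists (pickle q) => k.
have [m [m0 em lm]] : exists m, [/\ (0 < m)%N, e^-1 < m%:R & logn 2 m = k].
  (* The odd factor makes [m] exceed [e^-1] without affecting its 2-adic valuation. *)
  exists ((Num.bound e^-1).*2.+1 * 2 ^ k)%N; split.
  - by rewrite muln_gt0 expn_gt0.
  - apply: lt_le_trans (archi_boundP _) _; first by rewrite invr_ge0 ltW.
    rewrite ler_nat; apply: (@leq_trans (Num.bound e^-1).*2.+1).
      by rewrite -addnn -addnS leq_addr.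
    by rewrite leq_pmulr // expn_gt0.
  - by rewrite logn_Gauss ?pfactorK // coprime2n /= odd_double.
have m0R : 0 < m%:R :> R by rewrite ltr0n.
(* For [x] in this interval [(x - ratr q)^-1] lies between [m] and [m.+1], so it truncates to [m];
   the interval is within [e] of [q] because [e^-1 < m]. *)
exists `]ratr q + m.+1%:R^-1, ratr q + m%:R^-1[%classic; split.
- exact: itv_open.
- have [|p pJ] := @rat_in_itvoo R (ratr q + m.+1%:R^-1) (ratr q + m%:R^-1).
    by rewrite ltrD2l ltf_pV2 ?posrE ?ltr0n // ltr_nat.
  by exists (ratr p).
- move=> x /=; rewrite in_itv /= => /andP[x1 x2]; apply: eI.
  rewrite /ball /= distrC ger0_norm.
    by rewrite ltrBlDl (lt_trans x2) // ltrD2l invf_plt ?posrE //.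
  by rewrite subr_ge0 (le_trans _ (ltW x1)) // lerDl invr_ge0 //.
move=> x /=; rewrite in_itv /= => /andP[].
rewrite -ltrBrDl => x1; rewrite -ltrBlDl => x2.
have x0 : 0 < x - ratr q by rewrite (lt_trans _ x1) // invr_gt0 ltr0n.
rewrite /coordinate pickleK /= (@truncn_def _ _ m) //.
apply/andP; split; first by rewrite ltW // invf_pgt.
by rewrite invf_plt // posrE ltr0n.
Qed.

End real_coordinates.

(** In a nonempty space a family with dense union is nonempty, so a countable one is the image of a
    sequence, possibly with repetitions. *)
Lemma weakly_lindelof_dense_sequence (X : topologicalType) (U : set (set X)) :
  [set: X] !=set0 -> weakly_lindelof X -> open_cover U ->
  exists V : nat -> set X, (forall k, U (V k)) /\ dense (\bigcup_k V k).
Proof.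
move=> X0 XwL /XwL[W [WU /pfcard_geP[->|[V]] dW]].
  by have [x [_ []]] := dW _ X0 openT.
exists V; split=> [k|]; first exact/WU/funS.
move=> O O0 oO; have [x [Ox [A WA Ax]]] := dW O O0 oO.
have [k _ kA] := @surj _ _ _ _ V A WA.
by exists x; split=> //; exists k => //; rewrite kA.
Qed.

(** Given [I], take the [n] of [coordinateP]. By density [P] meets some [V n k], and the open part
    of [I] where coordinate [n] equals [k] avoids the set. *)
Lemma nowhere_dense_missing (R : realType) (X : topologicalType)
    (V : nat -> nat -> set X) (P : set X) :
  (forall n, dense (\bigcup_k V n k)) -> open P -> P !=set0 ->
  nowhere_dense [set x : R | forall n, P `&` V n (coordinate n x) = set0].
Proof.
move=> dV oP P0; apply: nowhere_dense_subset_open => I oI I0.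
have [n nI] := coordinateP _ oI I0.
have [y [Py [k _ Vy]]] := dV n P P0 oP.
have [J [oJ J0 JI Jk]] := nI k; exists J; split=> //.
rewrite -subset0 => x [Jx /(_ n)].
by rewrite Jk // -subset0 => /(_ y); apply.
Qed.

Theorem theorem2p11 (R : realType) (X : topologicalType)
    (X0 : [set: X] !=set0)
    (XwL : weakly_lindelof X)
    (Xpiw : card_lt (pi_weight X) (cov_meager R)) :
  weakly_rothberger X.
Proof.
move=> U Ucov.
have /choice[V VP] n := weakly_lindelof_dense_sequence _ _ X0 XwL (Ucov n).
have [[pi_open pi_sub] _] := pi_weightP X.
pose N P := [set x : R | forall n, P `&` V n (coordinate n x) = set0].
have [x xN] : exists x, forall P, pi_weight X P -> ~ N P x.
  (* Otherwise the sets [N P] form a meager cover no larger than the pi-base, so the two cardinals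
     would be equal. *)
  apply: contrapT => /forallNP xN; case: Xpiw => le_pi; apply.
  apply/card_eqPle; split=> //.
  apply: card_le_trans (card_image_le N (pi_weight X)).
  apply: (cov_meagerP R).2; split.
    move=> _ [P /pi_open[oP P0] <-]; apply: meager_nowhere_dense.
    by apply: nowhere_dense_missing => // n; case: (VP n).
  rewrite -subTset => x _; have /existsNP[P] := xN x.
  by move=> /not_implyP[piP /contrapT NPx]; exists (N P) => //; exists P.
exists (fun n => V n (coordinate n x)); first by move=> n; case: (VP n).
move=> O O0 oO; have [P piP PO] := pi_sub O oO O0.
have /existsNP[n /eqP/set0P[y [Py Vy]]] := xN P piP.
by exists y; split; [exact: PO|exists n].
Qed.
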